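(* There exists a group homomorphism $\overline{\tau}\colon\pi_1\Sigma_2\rightarrow\overline{\mathcal{H}}^\times$ satisfying $$\overline{\tau}(s_1)\equiv1+Ai,\quad\overline{\tau}(t_1)\equiv1+Bj,\quad\overline{\tau}(s_2)\equiv1+Aj,\quad\overline{\tau}(t_2)\equiv1+Bi\qquad\text{mod }(A,B)^2.$$
   Context: $\pi_1\Sigma_2=\langle s_1,t_1,s_2,t_2\mid[s_1,t_1][s_2,t_2]=1\rangle$ is the fundamental group of the closed orientable surface of genus two, with $[x,y]=xyx^{-1}y^{-1}$. $\overline{\mathcal{H}}=\mathbb{Z}[\![A,B]\!][i,j,k]$ is the quaternion algebra over the commutative ring $\mathbb{Z}[\![A,B]\!]$ of formal power series in two commuting variables with integer coefficients: it is the free $\mathbb{Z}[\![A,B]\!]$-module with basis $1,i,j,k$, where $A,B$ commute with $i,j,k$ and $i^2=j^2=k^2=-1$, $ij=k=-ji$, etc. (Hamilton's relations). $(A,B)^2$ is the square of the two-sided ideal of $\overline{\mathcal{H}}$ generated by $A$ and $B$, and $\overline{\mathcal{H}}^\times$ is the group of units. *)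

(* Defs.v *)
From HB Require Import structures.
From mathcomp Require Import all_boot all_algebra ring.
From mathcomp Require Import boolp classical_sets.

Set Implicit Arguments.
Unset Strict Implicit.
Unset Printing Implicit Defensive.

Import GRing.Theory.

(* The letter (x, false) stands for x and (x, true) for its inverse. *)
Definition word (X : choiceType) := seq (X * bool).

Section Presentation.
Variables (X : choiceType) (rels : set (word X)).
Local Open Scope quotient_scope.

Definition invw (u : word X) : word X := rev [seq (a.1, ~~ a.2) | a <- u].

(* Equality of words in the group with generators X and relators rels:
   equivalence closure of free reduction and deletion of relators. *)
Inductive pres_eq : word X -> word X -> Prop :=
| pres_refl u : pres_eq u u
| pres_sym u v : pres_eq u v -> pres_eq v u
| pres_trans u v w : pres_eq u v -> pres_eq v w -> pres_eq u w
| pres_cancel u v x b : pres_eq (u ++ [:: (x, b); (x, ~~ b)] ++ v) (u ++ v)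
| pres_relator u v r : rels r -> pres_eq (u ++ r ++ v) (u ++ v).

Definition pres_eqb (u v : word X) : bool := `[< pres_eq u v >].

Lemma pres_eqb_refl : reflexive pres_eqb.
Proof. by move=> u; apply/asboolP; exact: pres_refl. Qed.

Lemma pres_eqb_sym : symmetric pres_eqb.
Proof.
by move=> u v; apply/idP/idP => /asboolP h; apply/asboolP; exact: pres_sym.
Qed.

Lemma pres_eqb_trans : transitive pres_eqb.
Proof.
by move=> v u w /asboolP h /asboolP k; apply/asboolP; exact: pres_trans h k.
Qed.

Canonical pres_equiv : equiv_rel (word X) :=
  EquivRel pres_eqb pres_eqb_refl pres_eqb_sym pres_eqb_trans.

Definition presented := {eq_quot pres_equiv}.
HB.instance Definition _ := Choice.on presented.
HB.instance Definition _ := EqQuotient.on presented.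

Definition word_class (u : word X) : presented := \pi_presented u.

Definition pres_gen (x : X) : presented := word_class [:: (x, false)].

Definition pres_one : presented := word_class [::].
Definition pres_mul (a b : presented) : presented :=
  word_class (repr a ++ repr b).
Definition pres_inv (a : presented) : presented := word_class (invw (repr a)).

Lemma word_classP u v : reflect (pres_eq u v) (word_class u == word_class v).
Proof. by rewrite /word_class piE; exact: asboolP. Qed.

Lemma word_class_eq u v : pres_eq u v -> word_class u = word_class v.
Proof. by move=> h; apply/eqP/word_classP. Qed.

Lemma word_class_repr a : word_class (repr a) = a.
Proof. exact: reprK. Qed.

Lemma pres_eq_repr u : pres_eq (repr (word_class u)) u.
Proof. by apply/word_classP; rewrite word_class_repr. Qed.

Lemma pres_eq_ctx u v w w' : pres_eq w w' -> pres_eq (u ++ w ++ v) (u ++ w' ++ v).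
Proof.
elim=> {w w'} [w|w w' _ h|w1 w2 w3 _ h _ k|w w' x b|w w' r rr].
- exact: pres_refl.
- exact: pres_sym.
- exact: pres_trans h k.
- by have := pres_cancel (u ++ w) (w' ++ v) x b; rewrite -!catA.
- by have := pres_relator (u ++ w) (w' ++ v) rr; rewrite -!catA.
Qed.

Lemma pres_eq_cat u u' v v' :
  pres_eq u u' -> pres_eq v v' -> pres_eq (u ++ v) (u' ++ v').
Proof.
move=> h k; apply: (@pres_trans _ (u' ++ v)).
  exact: (pres_eq_ctx [::] v h).
by have := pres_eq_ctx u' [::] k; rewrite !cats0.
Qed.

Lemma invw_cons x b (u : word X) : invw ((x, b) :: u) = invw u ++ [:: (x, ~~ b)].
Proof. by rewrite /invw /= rev_cons cats1. Qed.

Lemma invwK : involutive invw.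
Proof.
move=> u; rewrite /invw map_rev revK -map_comp map_id_in // => -[x b] _ /=.
by rewrite negbK.
Qed.

Lemma pres_eq_mulV u : pres_eq (u ++ invw u) [::].
Proof.
elim: u => [|[x b] u ih]; first exact: pres_refl.
rewrite invw_cons.
apply: pres_trans (pres_cancel [::] [::] x b).
by have := pres_eq_ctx [:: (x, b)] [:: (x, ~~ b)] ih; rewrite /= -catA.
Qed.

Lemma pres_eq_Vmul u : pres_eq (invw u ++ u) [::].
Proof. by have := pres_eq_mulV (invw u); rewrite invwK. Qed.

Lemma pres_mulE u v :
  pres_mul (word_class u) (word_class v) = word_class (u ++ v).
Proof. by apply: word_class_eq; apply: pres_eq_cat; exact: pres_eq_repr. Qed.

Lemma pres_mulA : associative pres_mul.
Proof.
move=> a b c; rewrite -(word_class_repr a) -(word_class_repr b).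
by rewrite -(word_class_repr c) !pres_mulE catA.
Qed.

Lemma pres_mul1 : left_id pres_one pres_mul.
Proof. by move=> a; rewrite -(word_class_repr a) pres_mulE. Qed.

Lemma pres_mulr1 : right_id pres_one pres_mul.
Proof. by move=> a; rewrite -(word_class_repr a) pres_mulE cats0. Qed.

Lemma pres_mulV : left_inverse pres_one pres_inv pres_mul.
Proof.
move=> a; rewrite -{2}(word_class_repr a) pres_mulE.
exact/word_class_eq/pres_eq_Vmul.
Qed.

Lemma pres_mulrV : right_inverse pres_one pres_inv pres_mul.
Proof.
move=> a; rewrite -{1}(word_class_repr a) pres_mulE.
exact/word_class_eq/pres_eq_mulV.
Qed.

HB.instance Definition _ := isGroup.Build presented
  pres_mulA pres_mul1 pres_mulr1 pres_mulV pres_mulrV.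

End Presentation.

Inductive sigma2_gen := S1 | T1 | S2 | T2.

HB.instance Definition _ := gen_eqMixin sigma2_gen.
HB.instance Definition _ := gen_choiceMixin sigma2_gen.

(* [x, y] = x y x^-1 y^-1, unlike the library's [~ x, y] = x^-1 y^-1 x y. *)
Definition commw (X : choiceType) (x y : X) : word X :=
  [:: (x, false); (y, false); (x, true); (y, true)].

Definition pi1_Sigma2 : groupType :=
  presented [set commw S1 T1 ++ commw S2 T2].

Definition s1 : pi1_Sigma2 := pres_gen _ S1.
Definition t1 : pi1_Sigma2 := pres_gen _ T1.
Definition s2 : pi1_Sigma2 := pres_gen _ S2.
Definition t2 : pi1_Sigma2 := pres_gen _ T2.

Local Open Scope ring_scope.

(* psc f m n is the coefficient of A^m B^n. *)
Record powser2 (R : Type) := PowSer2 { psc : nat -> nat -> R }.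

HB.instance Definition _ (R : Type) := gen_eqMixin (powser2 R).
HB.instance Definition _ (R : Type) := gen_choiceMixin (powser2 R).

Section PowerSeries.
Variable R : comNzRingType.
Implicit Types f g h : powser2 R.

Lemma ps_eqP f g : (forall m n, psc f m n = psc g m n) -> f = g.
Proof.
by case: f g => [f] [g] /= fg; congr PowSer2; apply/funext => m; apply/funext.
Qed.

Definition ps_zero : powser2 R := PowSer2 (fun _ _ => 0).
Definition ps_opp f := PowSer2 (fun m n => - psc f m n).
Definition ps_add f g := PowSer2 (fun m n => psc f m n + psc g m n).
Definition ps_one : powser2 R :=
  PowSer2 (fun m n => ((m == 0%N) && (n == 0%N))%:R).
Definition ps_mul f g := PowSer2 (fun m n =>
  \sum_(i < m.+1) \sum_(j < n.+1) psc f i j * psc g (m - i) (n - j)).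

Lemma ps_addA : associative ps_add.
Proof. by move=> f g h; apply: ps_eqP => m n; exact: addrA. Qed.

Lemma ps_addC : commutative ps_add.
Proof. by move=> f g; apply: ps_eqP => m n; exact: addrC. Qed.

Lemma ps_add0 : left_id ps_zero ps_add.
Proof. by move=> f; apply: ps_eqP => m n; exact: add0r. Qed.

Lemma ps_addN : left_inverse ps_zero ps_opp ps_add.
Proof. by move=> f; apply: ps_eqP => m n; exact: addNr. Qed.

HB.instance Definition _ := GRing.isZmodule.Build (powser2 R)
  ps_addA ps_addC ps_add0 ps_addN.

Let trunc N f : {poly {poly R}} := \poly_(i < N) \poly_(j < N) psc f i j.

Let coef_trunc N f i j : (i < N)%N -> (j < N)%N -> (trunc N f)`_i`_j = psc f i j.
Proof. by move=> iN jN; rewrite coef_poly iN coef_poly jN. Qed.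

Let coef2M (P Q : {poly {poly R}}) m n : (P * Q)`_m`_n =
  \sum_(i < m.+1) \sum_(j < n.+1) P`_i`_j * Q`_(m - i)`_(n - j).
Proof. by rewrite coefM coef_sum; apply: eq_bigr => i _; rewrite coefM. Qed.

Let ps_mulE N f g m n : (m < N)%N -> (n < N)%N ->
  psc (ps_mul f g) m n = (trunc N f * trunc N g)`_m`_n.
Proof.
move=> mN nN; rewrite coef2M; apply: eq_bigr => i _; apply: eq_bigr => j _.
rewrite !coef_trunc //.
- exact: leq_ltn_trans (leq_subr _ _) mN.
- exact: leq_ltn_trans (leq_subr _ _) nN.
- exact: leq_ltn_trans (leq_ord i) mN.
- exact: leq_ltn_trans (leq_ord j) nN.
Qed.

Lemma ps_mulC : commutative ps_mul.
Proof.
move=> f g; apply: ps_eqP => m n; pose N := (maxn m n).+1.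
by rewrite !(@ps_mulE N) ?ltnS ?leq_maxl ?leq_maxr // mulrC.
Qed.

Lemma ps_mulA : associative ps_mul.
Proof.
move=> f g h; apply: ps_eqP => m n; pose N := (maxn m n).+1.
have [mN nN] : (m < N)%N /\ (n < N)%N by rewrite !ltnS leq_maxl leq_maxr.
have tE u v i j : (i <= m)%N -> (j <= n)%N ->
    (trunc N (ps_mul u v))`_i`_j = (trunc N u * trunc N v)`_i`_j.
  move=> im jn; have iN := leq_ltn_trans im mN; have jN := leq_ltn_trans jn nN.
  by rewrite coef_trunc // (ps_mulE _ _ iN jN).
rewrite !(@ps_mulE N) //.
transitivity ((trunc N f * (trunc N g * trunc N h))`_m`_n).
  rewrite !coef2M; apply: eq_bigr => i _; apply: eq_bigr => j _.
  by rewrite tE ?leq_subr.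
rewrite mulrA !coef2M; apply: eq_bigr => i _; apply: eq_bigr => j _.
by rewrite tE ?leq_ord.
Qed.

Lemma ps_mul1 : left_id ps_one ps_mul.
Proof.
move=> f; apply: ps_eqP => m n /=.
rewrite big_ord_recl [X in _ + X]big1 ?addr0; last first.
  by move=> i _; apply: big1 => j _; rewrite /= mul0r.
rewrite big_ord_recl [X in _ + X]big1 ?addr0; last by move=> j _; rewrite /= mul0r.
by rewrite /= mul1r !subn0.
Qed.

Lemma ps_mulDl : left_distributive ps_mul +%R.
Proof.
move=> f g h; apply: ps_eqP => m n /=.
rewrite -big_split; apply: eq_bigr => i _.
by rewrite -big_split; apply: eq_bigr => j _; rewrite /= mulrDl.
Qed.

Lemma ps_one_neq0 : ps_one != 0.
Proof.
by apply/eqP => /(congr1 (fun f => psc f 0 0)) /eqP; rewrite /= oner_eq0.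
Qed.

HB.instance Definition _ := GRing.Zmodule_isComNzRing.Build (powser2 R)
  ps_mulA ps_mulC ps_mul1 ps_mulDl ps_one_neq0.

Definition psA : powser2 R :=
  PowSer2 (fun m n => ((m == 1%N) && (n == 0%N))%:R).
Definition psB : powser2 R :=
  PowSer2 (fun m n => ((m == 0%N) && (n == 1%N))%:R).

End PowerSeries.

(* Quat a b c d is a + b i + c j + d k. *)
Record quat (R : Type) := Quat { q_1 : R; q_i : R; q_j : R; q_k : R }.

Definition quat_tuple (R : Type) (x : quat R) := (q_1 x, q_i x, q_j x, q_k x).
Definition tuple_quat (R : Type) (t : R * R * R * R) :=
  let: (a, b, c, d) := t in Quat a b c d.
Lemma quat_tupleK (R : Type) : cancel (@quat_tuple R) (@tuple_quat R).
Proof. by case. Qed.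

HB.instance Definition _ (R : choiceType) :=
  Choice.copy (quat R) (can_type (@quat_tupleK R)).

Section Quaternions.
Variable R : comNzRingType.
Implicit Types (a b : R) (x y z : quat R).

Definition quat_zero : quat R := Quat 0 0 0 0.
Definition quat_one : quat R := Quat 1 0 0 0.
Definition quat_opp x := Quat (- q_1 x) (- q_i x) (- q_j x) (- q_k x).
Definition quat_add x y :=
  Quat (q_1 x + q_1 y) (q_i x + q_i y) (q_j x + q_j y) (q_k x + q_k y).
Definition quat_scale a x := Quat (a * q_1 x) (a * q_i x) (a * q_j x) (a * q_k x).
Definition quat_mul x y :=
  Quat (q_1 x * q_1 y - q_i x * q_i y - q_j x * q_j y - q_k x * q_k y)
       (q_1 x * q_i y + q_i x * q_1 y + q_j x * q_k y - q_k x * q_j y)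
       (q_1 x * q_j y - q_i x * q_k y + q_j x * q_1 y + q_k x * q_i y)
       (q_1 x * q_k y + q_i x * q_j y - q_j x * q_i y + q_k x * q_1 y).

Ltac quat_ring := repeat (case=> [????] || move=> ?);
  rewrite /quat_add /quat_opp /quat_mul /quat_scale /=; congr Quat; ring.

Lemma quat_addA : associative quat_add. Proof. quat_ring. Qed.
Lemma quat_addC : commutative quat_add. Proof. quat_ring. Qed.
Lemma quat_add0 : left_id quat_zero quat_add. Proof. quat_ring. Qed.
Lemma quat_addN : left_inverse quat_zero quat_opp quat_add.
Proof. quat_ring. Qed.

HB.instance Definition _ := GRing.isZmodule.Build (quat R)
  quat_addA quat_addC quat_add0 quat_addN.

Lemma quat_mulA : associative quat_mul. Proof. quat_ring. Qed.
Lemma quat_mul1 : left_id quat_one quat_mul. Proof. quat_ring. Qed.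
Lemma quat_mulr1 : right_id quat_one quat_mul. Proof. quat_ring. Qed.
Lemma quat_mulDl : left_distributive quat_mul quat_add. Proof. quat_ring. Qed.
Lemma quat_mulDr : right_distributive quat_mul quat_add. Proof. quat_ring. Qed.
Lemma quat_one_neq0 : quat_one != 0.
Proof. by apply/eqP => /(congr1 (@q_1 R)) /eqP; rewrite oner_eq0. Qed.

HB.instance Definition _ := GRing.Zmodule_isNzRing.Build (quat R)
  quat_mulA quat_mul1 quat_mulr1 quat_mulDl quat_mulDr quat_one_neq0.

Lemma quat_scaleA a b x : quat_scale a (quat_scale b x) = quat_scale (a * b) x.
Proof. move: a b x; quat_ring. Qed.
Lemma quat_scale1 : left_id 1 quat_scale. Proof. quat_ring. Qed.
Lemma quat_scaleDr : right_distributive quat_scale quat_add. Proof. quat_ring. Qed.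
Lemma quat_scaleDl x : {morph quat_scale^~ x : a b / a + b >-> quat_add a b}.
Proof. move: x; quat_ring. Qed.

HB.instance Definition _ := GRing.Zmodule_isLmodule.Build R (quat R)
  quat_scaleA quat_scale1 quat_scaleDr quat_scaleDl.

Lemma quat_scaleAl a x y :
  quat_scale a (quat_mul x y) = quat_mul (quat_scale a x) y.
Proof. move: a x y; quat_ring. Qed.

HB.instance Definition _ :=
  GRing.Lmodule_isLalgebra.Build R (quat R) quat_scaleAl.

Lemma quat_scaleAr a x y :
  quat_scale a (quat_mul x y) = quat_mul x (quat_scale a y).
Proof. move: a x y; quat_ring. Qed.

HB.instance Definition _ :=
  GRing.Lalgebra_isAlgebra.Build R (quat R) quat_scaleAr.

(* Units are decided classically; the inverse of a unit is its two-sided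
   inverse, and by the library's convention x^-1 = x for non-units. *)
Definition quat_unit : pred (quat R) :=
  fun x => `[< exists y, y * x = 1 /\ x * y = 1 >].
Definition quat_inv x : quat R :=
  if pselect (exists y, y * x = 1 /\ x * y = 1) is left h then projT1 (cid h)
  else x.

Lemma quat_mulVr : {in quat_unit, left_inverse 1 quat_inv *%R}.
Proof.
move=> x /asboolP h; rewrite /quat_inv; case: pselect => // h'.
by case: (cid h') => y [].
Qed.

Lemma quat_mulrV : {in quat_unit, right_inverse 1 quat_inv *%R}.
Proof.
move=> x /asboolP h; rewrite /quat_inv; case: pselect => // h'.
by case: (cid h') => y [].
Qed.

Lemma quat_unitP x y : y * x = 1 /\ x * y = 1 -> quat_unit x.
Proof. by move=> h; apply/asboolP; exists y. Qed.

Lemma quat_inv_out : {in [predC quat_unit], quat_inv =1 id}.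
Proof. by move=> x /asboolPn h; rewrite /quat_inv; case: pselect. Qed.

HB.instance Definition _ := GRing.NzRing_hasMulInverse.Build (quat R)
  quat_mulVr quat_mulrV quat_unitP quat_inv_out.

Definition quatI : quat R := Quat 0 1 0 0.
Definition quatJ : quat R := Quat 0 0 1 0.
Definition quatK : quat R := Quat 0 0 0 1.

Lemma quat_basisE x :
  x = q_1 x *: 1 + q_i x *: quatI + q_j x *: quatJ + q_k x *: quatK.
Proof.
by case: x => a b c d; rewrite -[RHS]/(quat_add _ _) /quat_add /=;
   congr Quat; rewrite ?mulr1 ?mulr0 ?addr0 ?add0r.
Qed.

Lemma quat_hamilton :
  [/\ quatI * quatI = -1, quatJ * quatJ = -1 & quatK * quatK = -1] /\
  [/\ quatI * quatJ = quatK, quatJ * quatK = quatI & quatK * quatI = quatJ] /\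
  [/\ quatJ * quatI = - quatK, quatK * quatJ = - quatI &
      quatI * quatK = - quatJ].
Proof.
by do ![split]; rewrite -[LHS]/(quat_mul _ _) /quat_mul
  -?[RHS]/(quat_opp (Quat _ _ _ _)) /quat_opp /=; congr Quat; ring.
Qed.

End Quaternions.

Section Units.
Variable R : unitRingType.

Record units := Units { uval :> R; uvalP : uval \is a GRing.unit }.

HB.instance Definition _ := [isSub for uval].
HB.instance Definition _ := [Choice of units by <:].

Implicit Types u v : units.

Definition units_one : units := Units (unitr1 R).
Lemma units_mul_subproof u v : uval u * uval v \is a GRing.unit.
Proof. by rewrite unitrMl uvalP. Qed.
Definition units_mul u v := Units (units_mul_subproof u v).
Lemma units_inv_subproof u : (uval u)^-1 \is a GRing.unit.
Proof. by rewrite unitrV uvalP. Qed.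
Definition units_inv u := Units (units_inv_subproof u).

Lemma units_mulA : associative units_mul.
Proof. by move=> u v w; apply: val_inj; exact: mulrA. Qed.
Lemma units_mul1 : left_id units_one units_mul.
Proof. by move=> u; apply: val_inj; exact: mul1r. Qed.
Lemma units_mulr1 : right_id units_one units_mul.
Proof. by move=> u; apply: val_inj; exact: mulr1. Qed.
Lemma units_mulV : left_inverse units_one units_inv units_mul.
Proof. by move=> u; apply: val_inj; exact: mulVr (uvalP u). Qed.
Lemma units_mulrV : right_inverse units_one units_inv units_mul.
Proof. by move=> u; apply: val_inj; exact: mulrV (uvalP u). Qed.

HB.instance Definition _ := isGroup.Build units
  units_mulA units_mul1 units_mulr1 units_mulV units_mulrV.

End Units.

Section Ideals.
Local Open Scope classical_set_scope.
Variable R : nzRingType.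

Definition two_sided_ideal (I : set R) : Prop :=
  [/\ I 0, forall x y, I x -> I y -> I (x - y),
      forall a x, I x -> I (a * x) & forall a x, I x -> I (x * a)].

Definition ideal_gen (S : set R) : set R := smallest two_sided_ideal S.

Definition ideal_mul (I J : set R) : set R :=
  ideal_gen [set x * y | x in I & y in J].

Definition congr_mod (I : set R) (x y : R) : Prop := I (x - y).

End Ideals.

(* Z[[A, B]][i, j, k]; a scalar a of Z[[A, B]] embeds in it as a%:A. *)
Definition Hbar : unitAlgType (powser2 int) := quat (powser2 int).

Definition A : powser2 int := psA int.
Definition B : powser2 int := psB int.
Definition i : Hbar := quatI (powser2 int).
Definition j : Hbar := quatJ (powser2 int).

Definition ideal_AB : set Hbar := ideal_gen [set A%:A; B%:A]%classic.
Definition ideal_AB2 : set Hbar := ideal_mul ideal_AB ideal_AB.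

(* Main.v *)
(* With S1 = 1 + A i and S2 = 1 + A j fixed, a quaternion C of norm 1 is both
   of the form [S1, T1] and of the form [T2, S2] as soon as S1^-1 C has the
   trace of S1^-1 and C S2 has the trace of S2.  These conditions and the norm
   equation cut out a rational curve; conjugating elements T1 and T2 for
   C = 1 + (2AB / D) (- AB + B (i - j) + k), D = 1 + 2 B^2 + A^2 B^2, are
     T1 = 1 + B^2 + B (1 + AB) j + B (B - A) k,
     T2 = 1 + B^2 + B (1 + AB) i + B (A - B) k. *)
Require Import Defs.
From HB Require Import structures.
From mathcomp Require Import all_boot all_algebra ring zify.
From mathcomp Require Import boolp classical_sets.

Set Implicit Arguments.
Unset Strict Implicit.
Unset Printing Implicit Defensive.

Import GRing.Theory.
Local Open Scope ring_scope.

(** * Homomorphisms out of a presented group *)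

Section PresentationUniversal.
Variables (X : choiceType) (rels : set (word X)) (G : groupType) (f : X -> G).
Local Open Scope group_scope.

Fixpoint evalw (u : word X) : G :=
  if u is a :: v then (if a.2 then (f a.1)^-1 else f a.1) * evalw v else 1.

Lemma evalw_cat u v : evalw (u ++ v) = evalw u * evalw v.
Proof. by elim: u => [|a u ih] /=; rewrite ?mul1g // ih mulgA. Qed.

Hypothesis f_rels : forall r, rels r -> evalw r = 1.

Lemma evalw_pres_eq u v : pres_eq rels u v -> evalw u = evalw v.
Proof.
elim=> {u v} [//|u v _ -> //|u v w _ -> _ -> //|u v x b|u v r /f_rels r1].
- by case: b; rewrite !evalw_cat /= mulg1 ?mulVg ?mulgV mul1g.
- by rewrite !evalw_cat r1 mul1g.
Qed.

(** Von Dyck's theorem: evaluating the chosen representative of a class is well defined and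
    multiplicative, since [evalw] is constant on classes. *)
Lemma presented_hom_ex : exists tau : {multiplicative presented rels -> G},
  forall x, tau (pres_gen rels x) = f x.
Proof.
pose t (p : presented rels) := evalw (repr p).
have tM : {morph t : p q / p * q}.
  by move=> p q; rewrite /t -evalw_cat; exact/evalw_pres_eq/pres_eq_repr.
pose tmul := isMultiplicative.Build _ _ t tM.
pose tau : {multiplicative _ -> _} := HB.pack t tmul.
exists tau => x; rewrite /= /t (evalw_pres_eq (pres_eq_repr _ _)) /=.
by rewrite mulg1.
Qed.

End PresentationUniversal.

(** Moves the surface relation from the unit group to the ring, where it can be computed; [uval] is
    injective. *)
Lemma evalw_surface_relator (R : unitRingType) (f : sigma2_gen -> units R) :
  (uval (f S1) * uval (f T1) * (uval (f S1))^-1 * (uval (f T1))^-1) *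
  (uval (f S2) * uval (f T2) * (uval (f S2))^-1 * (uval (f T2))^-1) = 1 ->
  evalw f (commw S1 T1 ++ commw S2 T2) = 1%g.
Proof.
move=> f_rel; apply: val_inj; rewrite -[RHS]/(1 : R) -f_rel evalw_cat /=.
by rewrite !mulr1 !mulrA.
Qed.

(** * Inverting power series with constant term 1 *)

Section PowerSeriesInverse.
Variable R : comNzRingType.
Implicit Types f g h : powser2 R.

Lemma psc_mul f g m n : psc (f * g) m n =
  \sum_(i < m.+1) \sum_(j < n.+1) psc f i j * psc g (m - i) (n - j).
Proof. by []. Qed.

Lemma psc00D f g : psc (f + g) 0 0 = psc f 0 0 + psc g 0 0.
Proof. by []. Qed.

Lemma psc00M f g : psc (f * g) 0 0 = psc f 0 0 * psc g 0 0.
Proof. by rewrite psc_mul !big_ord1. Qed.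

Lemma psc_exp_small h k m n :
  psc h 0 0 = 0 -> (m + n < k)%N -> psc (h ^+ k) m n = 0.
Proof.
move=> h0; elim: k m n => // k ih m n mnk.
rewrite exprS psc_mul big1 // => i _; apply: big1 => j _.
(* The term with [i = j = 0] dies because [h] has no constant term; every other term leaves total
   degree below [k] for [h ^+ k]. *)
case: (posnP (i + j)) => [/eqP|ij0].
  by rewrite addn_eq0 => /andP[/eqP-> /eqP->]; rewrite h0 mul0r.
by rewrite ih ?mulr0 //; have := ltn_ord i; have := ltn_ord j; lia.
Qed.

(** Geometric series in [h = 1 - f]: since [h ^+ k] has order at least [k], each coefficient of the
    partial sums [G N] is eventually constant. *)
Lemma ps_inv_ex f : psc f 0 0 = 1 -> exists g, f * g = 1.
Proof.
move=> f0; pose h := 1 - f.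
have h0 : psc h 0 0 = 0 by rewrite -[LHS]/(1 - psc f 0 0) f0 subrr.
pose G N := \sum_(k < N) h ^+ k.
have fG N : f * G N = 1 - h ^+ N.
  by rewrite -opprB subrX1 -mulNr opprB /h opprB addrC subrK.
have G_stable N p m n : (m + n < N)%N -> psc (G (N + p)%N) m n = psc (G N) m n.
  move=> mnN; elim: p => [|p ih]; first by rewrite addn0.
  rewrite addnS /G big_ord_recr -ih -[LHS]/(psc _ m n + psc _ m n).
  by rewrite [X in _ + X]psc_exp_small ?addr0 // (leq_trans mnN) ?leq_addr.
(* The coefficient at [m, n] is stable from [N = (m + n).+1] on, so it is read off there. *)
exists (PowSer2 (fun m n => psc (G (m + n).+1) m n)); apply: ps_eqP => m n.
transitivity (psc (f * G (m + n).+1) m n); last first.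
  by rewrite fG -[LHS]/(psc 1 m n - psc _ m n) psc_exp_small ?subr0.
rewrite !psc_mul; apply: eq_bigr => i _; apply: eq_bigr => j _; congr (_ * _).
by rewrite /= -(G_stable (m - i + (n - j)).+1 (i + j)%N) //; congr (psc (G _) _ _);
  have := ltn_ord i; have := ltn_ord j; lia.
Qed.

End PowerSeriesInverse.

(** * Norms, inverses and the two commutators *)

Section QuaternionNorm.
Variable R : comNzRingType.
Implicit Types (a b g h : R) (x y : quat R).

Definition quat_conj x := Quat (q_1 x) (- q_i x) (- q_j x) (- q_k x).
Definition quat_norm x := q_1 x ^+ 2 + q_i x ^+ 2 + q_j x ^+ 2 + q_k x ^+ 2.

Lemma quat_mul_conj x : x * quat_conj x = (quat_norm x)%:A.
Proof.
case: x => a b c d; rewrite /quat_norm /quat_conj.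
by rewrite -[LHS]/(quat_mul _ _) -[RHS]/(quat_scale _ _) /quat_mul /quat_scale /=;
  congr Quat; ring.
Qed.

Lemma quat_conj_mul x : quat_conj x * x = (quat_norm x)%:A.
Proof.
case: x => a b c d; rewrite /quat_norm /quat_conj.
by rewrite -[LHS]/(quat_mul _ _) -[RHS]/(quat_scale _ _) /quat_mul /quat_scale /=;
  congr Quat; ring.
Qed.

Lemma quat_norm_inv x g : quat_norm x * g = 1 ->
  (g *: quat_conj x) * x = 1 /\ x * (g *: quat_conj x) = 1.
Proof.
move=> xg; rewrite -scalerAl -scalerAr quat_conj_mul quat_mul_conj scalerA.
by rewrite mulrC xg scale1r.
Qed.

Lemma quat_norm_unit x g : quat_norm x * g = 1 -> x \is a GRing.unit.
Proof. by move=> /quat_norm_inv [gx xg]; apply/unitrP; exists (g *: quat_conj x). Qed.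

(** The inverse is chosen classically; cancelling the unit [x] identifies it with the explicit
    formula. *)
Lemma quat_invE x g : quat_norm x * g = 1 -> x^-1 = g *: quat_conj x.
Proof.
move=> xg; have [_ xV] := quat_norm_inv xg.
by apply: (mulrI (quat_norm_unit xg)); rewrite xV mulrV ?(quat_norm_unit xg).
Qed.

Variables a b : R.

Definition qS1 : quat R := Quat 1 a 0 0.
Definition qS2 : quat R := Quat 1 0 a 0.
Definition qT1 : quat R := Quat (1 + b ^+ 2) 0 (b * (1 + a * b)) (b * (b - a)).
Definition qT2 : quat R := Quat (1 + b ^+ 2) (b * (1 + a * b)) 0 (b * (a - b)).

Local Notation I := (quatI R).
Local Notation J := (quatJ R).
Local Notation K := (quatK R).

Lemma qS1E : qS1 = 1 + a *: I.
Proof. by rewrite -[RHS]/(quat_add _ _) /quat_add /=; congr Quat; ring. Qed.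

Lemma qS2E : qS2 = 1 + a *: J.
Proof. by rewrite -[RHS]/(quat_add _ _) /quat_add /=; congr Quat; ring. Qed.

(** Isolates the error term as a combination of [b * b] and [a * b], the form in which its
    membership in the squared ideal is visible. *)
Lemma qT1E :
  qT1 = (b * b) *: (1 + a *: J + K) + (a * b) *: (- K) + (1 + b *: J).
Proof. by rewrite -[RHS]/(quat_add _ _) /quat_add /=; congr Quat; ring. Qed.

Lemma qT2E :
  qT2 = (b * b) *: (1 + a *: I - K) + (a * b) *: K + (1 + b *: I).
Proof. by rewrite -[RHS]/(quat_add _ _) /quat_add /=; congr Quat; ring. Qed.

Let normS := 1 + a ^+ 2.
Let normT := (1 + b ^+ 2) * (1 + 2 * b ^+ 2 + (a * b) ^+ 2).

Lemma quat_norm_qS : quat_norm qS1 = normS /\ quat_norm qS2 = normS.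
Proof. by rewrite /quat_norm /normS /=; split; ring. Qed.

Lemma quat_norm_qT : quat_norm qT1 = normT /\ quat_norm qT2 = normT.
Proof. by rewrite /quat_norm /normT /=; split; ring. Qed.

(** This is D C, the common commutator C with its denominator D cleared. The factor [c] below is
    [normS * normT] divided by D. *)
Let comm : quat R := Quat (1 + 2 * b ^+ 2 - (a * b) ^+ 2)
  (2 * a * b ^+ 2) (- (2 * a * b ^+ 2)) (2 * a * b).
Let c := (1 + a ^+ 2) * (1 + b ^+ 2).

Lemma qS1_qT1_comm : qS1 * qT1 * quat_conj qS1 * quat_conj qT1 = c *: comm.
Proof.
rewrite /c -[LHS]/(quat_mul (quat_mul (quat_mul _ _) _) _).
by rewrite -[RHS]/(quat_scale _ _) /quat_mul /quat_scale /=; congr Quat; ring.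
Qed.

(** After division by the norms, the second commutator is the conjugate of C, which is its inverse
    because C has norm 1. *)
Lemma qS2_qT2_comm :
  qS2 * qT2 * quat_conj qS2 * quat_conj qT2 = c *: quat_conj comm.
Proof.
rewrite /c -[LHS]/(quat_mul (quat_mul (quat_mul _ _) _) _).
by rewrite -[RHS]/(quat_scale _ _) /quat_mul /quat_scale /=; congr Quat; ring.
Qed.

Lemma qS_qT_relation g h : normS * g = 1 -> normT * h = 1 ->
  (qS1 * qT1 * qS1^-1 * qT1^-1) * (qS2 * qT2 * qS2^-1 * qT2^-1) = 1.
Proof.
have [nS1 nS2] := quat_norm_qS; have [nT1 nT2] := quat_norm_qT.
move=> Sg Th; rewrite (@quat_invE qS1 g) ?nS1 // (@quat_invE qS2 g) ?nS2 //.
rewrite (@quat_invE qT1 h) ?nT1 // (@quat_invE qT2 h) ?nT2 //.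
rewrite -!scalerAr -!scalerAl !scalerA qS1_qT1_comm qS2_qT2_comm.
rewrite -!scalerAr -!scalerAl quat_mul_conj !scalerA.
(* [comm] has norm D squared, and c D = [normS * normT], so all scalars collect into squares of
   quantities equal to 1. *)
transitivity (((normS * g) ^+ 2 * (normT * h) ^+ 2)%:A : quat R).
  by congr (_ *: _); rewrite /c /quat_norm /normS /normT /=; ring.
by rewrite Sg Th !expr1n mulr1 scale1r.
Qed.

End QuaternionNorm.

(** * Membership in the square of the ideal *)

Section GeneratedIdeal.
Local Open Scope classical_set_scope.
Variable R : nzRingType.

Lemma ideal_gen_ideal (S : set R) : two_sided_ideal (ideal_gen S).
Proof.
split=> [I [[]]//|x y Sx Sy I IS|a x Sx I IS|a x Sx I IS].
- by case: (IS) => -[_ IB _ _] _; exact: IB (Sx _ IS) (Sy _ IS).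
- by case: (IS) => -[_ _ Il _] _; exact: Il (Sx _ IS).
- by case: (IS) => -[_ _ _ Ir] _; exact: Ir (Sx _ IS).
Qed.

Lemma ideal_mulM (I J : set R) x y : I x -> J y -> ideal_mul I J (x * y).
Proof. by move=> Ix Jy; apply: sub_gen_smallest; exists x => //; exists y. Qed.

End GeneratedIdeal.

Lemma ideal_AB2_0 : ideal_AB2 0.
Proof.
by have [] := ideal_gen_ideal (R := Hbar)
  [set x * y | x in ideal_AB & y in ideal_AB]%classic.
Qed.

Lemma ideal_AB2_comb (p q : Hbar) : ideal_AB2 ((B * B) *: p + (A * B) *: q).
Proof.
have AI : ideal_AB A%:A by apply: sub_gen_smallest; left.
have BI : ideal_AB B%:A by apply: sub_gen_smallest; right.
have [I0 IB _ Ir] := ideal_gen_ideal (R := Hbar)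
  [set x * y | x in ideal_AB & y in ideal_AB]%classic.
have Isc a b r : ideal_AB a%:A -> ideal_AB b%:A -> ideal_AB2 ((a * b) *: r).
  move=> Ia Ib; rewrite -scalerA -[b *: r]mulr_algl -[a *: (_ * r)]mulr_algl mulrA.
  by apply: Ir; exact: ideal_mulM.
(* [two_sided_ideal] gives closure under differences, so the sum is written as X - (- Y). *)
rewrite -[X in _ + X]opprK; apply: IB; first exact: Isc.
by rewrite -scalerN; exact: Isc.
Qed.

Theorem lemma20 :
  exists tau : {multiplicative pi1_Sigma2 -> units Hbar},
    [/\ congr_mod ideal_AB2 (uval (tau s1)) (1 + A *: i),
        congr_mod ideal_AB2 (uval (tau t1)) (1 + B *: j),
        congr_mod ideal_AB2 (uval (tau s2)) (1 + A *: j) &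
        congr_mod ideal_AB2 (uval (tau t2)) (1 + B *: i)].
Proof.
have [nS1 nS2] := quat_norm_qS A; have [nT1 nT2] := quat_norm_qT A B.
have [A0 B0] : psc A 0 0 = 0 /\ psc B 0 0 = 0 by [].
(* The norms of all four quaternions have constant term 1, hence are invertible series. *)
have [|g Sg] := @ps_inv_ex _ (1 + A ^+ 2).
  by rewrite psc00D psc00M A0 mul0r addr0.
have [|h Th] := @ps_inv_ex _ ((1 + B ^+ 2) * (1 + 2 * B ^+ 2 + (A * B) ^+ 2)).
  by rewrite !(psc00D, psc00M) A0 B0 !(mul0r, mulr0, addr0) mulr1.
have uS1 : (qS1 A : Hbar) \is a GRing.unit.
  by apply: (@quat_norm_unit _ _ g); rewrite nS1.
have uS2 : (qS2 A : Hbar) \is a GRing.unit.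
  by apply: (@quat_norm_unit _ _ g); rewrite nS2.
have uT1 : (qT1 A B : Hbar) \is a GRing.unit.
  by apply: (@quat_norm_unit _ _ h); rewrite nT1.
have uT2 : (qT2 A B : Hbar) \is a GRing.unit.
  by apply: (@quat_norm_unit _ _ h); rewrite nT2.
pose f x : units Hbar := match x with
  S1 => Units uS1 | T1 => Units uT1 | S2 => Units uS2 | T2 => Units uT2 end.
have f_rels r : [set commw S1 T1 ++ commw S2 T2]%classic r -> evalw f r = 1%g.
  by move=> ->; apply: evalw_surface_relator; exact: qS_qT_relation Sg Th.
have [tau tauE] := presented_hom_ex f_rels.
exists tau; rewrite /s1 /t1 /s2 /t2 !tauE /congr_mod; split.
(* The images of [s1] and [s2] satisfy their congruences as equalities; those of [t1] and [t2] leave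
   the error terms of [qT1E] and [qT2E]. *)
- rewrite -[X in ideal_AB2 X]/(qS1 A - (1 + A *: quatI _)) qS1E subrr.
  exact: ideal_AB2_0.
- rewrite -[X in ideal_AB2 X]/(qT1 A B - (1 + B *: quatJ _)) qT1E addrK.
  exact: ideal_AB2_comb.
- rewrite -[X in ideal_AB2 X]/(qS2 A - (1 + A *: quatJ _)) qS2E subrr.
  exact: ideal_AB2_0.
- rewrite -[X in ideal_AB2 X]/(qT2 A B - (1 + B *: quatI _)) qT2E addrK.
  exact: ideal_AB2_comb.
Qed.
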